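(* Let $d\ge 2$, let $\Omega\subset\mathbb{R}^d$ be a bounded polytopal domain, and let $\mathcal{M}=(\mathcal{T},\mathcal{E})$ be a Voronoi tessellation over $\Omega$. Then $\mathcal{M}$ is omnidirectionally acyclic; that is, for every direction $\vec{\omega}\in\mathbb{S}^{d-1}$ the directed dual mesh $\mathcal{M}^*_{\vec{\omega}}$ contains no directed cycle.
   Context: Polytopal mesh. A polytopal mesh over $\Omega$ is a pair $(\mathcal{T},\mathcal{E})$ where: (1) the element set $\mathcal{T}$ is a (finite) subdivision of $\Omega$ into disjoint $d$-dimensional polytopes with $\overline{\Omega}=\bigcup_{T\in\mathcal{T}}\overline{T}$; (2) the facet set $\mathcal{E}$ is the set of all $(d-1)$-dimensional facets associated with the subdivision $\mathcal{T}$, including those on the boundary $\partial\Omega$; the elements of $\mathcal{E}$ form a partition of the mesh skeleton $\bigcup_{T\in\mathcal{T}}\partial T$. For $T\in\mathcal{T}$ put $\mathcal{E}_T:=\{F\in\mathcal{E} : F\subset\partial T\}$, and for $T_1,T_2\in\mathcal{T}$ put $\mathcal{E}_{T_1,T_2}:=\mathcal{E}_{T_1}\cap\mathcal{E}_{T_2}$, the set of facets shared by $T_1$ and $T_2$ (possibly empty). For two elements $T_i,T_j$ sharing a facet, $\vec{\nu}_{i,j}(\vec{x})$ denotes the unit normal vector to $\partial T_i$, pointing outward from $T_i$, at points $\vec{x}$ of the facet(s) in $\mathcal{E}_{T_i,T_j}$. Voronoi tessellation. A Voronoi tessellation (Voronoi mesh) over a $d$-dimensional polytopal domain $\Omega$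 is a polytopal mesh $(\mathcal{T},\mathcal{E})$ over $\Omega$ in which each element $T_i\in\mathcal{T}$ has an associated centre $\vec{v}_i\in\mathbb{R}^d$ (not required to lie in $\Omega$) such that $$T_i=\{\vec{x}\in\Omega : \|\vec{x}-\vec{v}_i\|_2<\|\vec{x}-\vec{v}_j\|_2 \text{ for all } j\neq i\}.$$ Directed dual mesh. For a direction $\vec{\omega}$, the directed dual mesh $\mathcal{M}^*_{\vec{\omega}}=(\mathcal{T}^*,\mathcal{E}^* )$ of a polytopal mesh $\mathcal{M}=(\mathcal{T},\mathcal{E})$ is the directed graph with vertex set $\mathcal{T}^*=\mathcal{T}$ and edge set $$\mathcal{E}^*=\{(T_i,T_j)\in\mathcal{T}\times\mathcal{T} : T_i\ne T_j,\ \mathcal{E}_{T_i,T_j}\neq\emptyset,\ \vec{\omega}\cdot\vec{\nu}_{i,j}(\vec{x})>0\},$$ where the last condition is for $\vec{x}$ on the shared facet(s) in $\mathcal{E}_{T_i,T_j}$. Pairs with $\vec{\omega}\cdot\vec{\nu}_{i,j}=0$ contribute no edge. Omnidirectionally acyclic. A mesh $\mathcal{M}$ is omnidirectionally acyclic if $\mathcal{M}^*_{\vec{\omega}}$ is acyclic (has no directed cycle) for all directions $\vec{\omega}\in\mathbb{S}^{d-1}$, the unit sphere in $\mathbb{R}^d$. *)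

(* Defs.v *)
From HB Require Import structures.
From mathcomp Require Import all_boot all_order all_algebra.
From mathcomp Require Import all_classical all_reals all_analysis.

Set Implicit Arguments.
Unset Strict Implicit.
Unset Printing Implicit Defensive.

Import Order.TTheory GRing.Theory Num.Theory.
Import numFieldNormedType.Exports.

Local Open Scope classical_set_scope.
Local Open Scope ring_scope.

(* The library norm on 'rV[R]_d is the sup norm (it induces the same topology
   and the same bounded sets), hence a separate Euclidean norm. *)
Section Euclid.
Variables (R : realType) (d : nat).
Implicit Types x y : 'rV[R]_d.

Definition dot x y : R := \sum_(i < d) x 0 i * y 0 i.

Definition norm2 x : R := Num.sqrt (dot x x).

Definition sphere : set 'rV[R]_d := [set w | norm2 w = 1].

End Euclid.

Section Polytopes.
Variables (R : realType) (d : nat).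
Local Notation pt := 'rV[R]_d.
Implicit Types (H A P T F : set pt).

Definition boundary A : set pt := closure A `\` interior A.

(* A pair (a, b) encodes the closed half-space a . x <= b. *)
Definition polyhedron (hs : seq (pt * R)) : set pt :=
  [set x | {in hs, forall h, dot h.1 x <= h.2}].

Definition hyperplane (a : pt) (b : R) : set pt := [set x | dot a x = b].

Definition relative_interior H A : set pt :=
  [set x | H x /\ within H (nbhs x) A].

(* Relatively open, not necessarily convex (nor connected) polyhedral subsets
   of the affine space H, of the same dimension as H: nonempty relative
   interiors in H of finite unions of convex polyhedra. *)
Definition open_polyhedral_in H P : Prop :=
  P !=set0 /\
  exists hss : seq (seq (pt * R)),
    P = relative_interior H (\bigcup_(hs in [set` hss]) polyhedron hs).

Definition open_polytope_in H P : Prop :=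
  open_polyhedral_in H P /\ bounded_set P.

Definition polytopal_domain (Omega : set pt) : Prop :=
  open_polyhedral_in setT Omega /\ connected Omega.

Definition full_dim_polytope T : Prop := open_polytope_in setT T.

Definition facet_polytope F : Prop :=
  exists (a : pt) (b : R), a != 0 /\ open_polytope_in (hyperplane a b) F.

(* Near a point x in the relative interior of a flat piece of its boundary,
   an open polytope lying on one side of that piece is a half-space; the unit
   normal pointing out of that half-space is the outward normal at x. No nu
   satisfies this at the other boundary points (edges, vertices). *)
Definition outward_unit_normal T (x nu : pt) : Prop :=
  norm2 nu = 1 /\ \forall y \near x, T y <-> dot nu (y - x) < 0.

End Polytopes.

Section Meshes.
Variables (R : realType) (d : nat).
Local Notation pt := 'rV[R]_d.

Record mesh := Mesh {
  elements : set (set pt);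
  facets : set (set pt) }.

Implicit Types (Omega T F : set pt) (M : mesh).

(* Elements are open and facets relatively open, so that both families consist
   of disjoint sets whose closures cover the domain closure, respectively the
   skeleton. Each facet is an interface between two elements or a boundary
   facet. *)
Definition polytopal_mesh Omega M : Prop :=
  [/\ finite_set (elements M),
      (forall T, elements M T -> full_dim_polytope T /\ T `<=` Omega),
      (forall T1 T2, elements M T1 -> elements M T2 -> T1 <> T2 ->
         T1 `&` T2 = set0) &
      closure Omega = \bigcup_(T in elements M) closure T] /\
  [/\ finite_set (facets M),
      (forall F, facets M F -> facet_polytope F),
      (forall F1 F2, facets M F1 -> facets M F2 -> F1 <> F2 ->
         F1 `&` F2 = set0),
      \bigcup_(T in elements M) boundary T =
        \bigcup_(F in facets M) closure F &
      (forall F, facets M F ->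
         (exists T1 T2, [/\ elements M T1, elements M T2, T1 <> T2 &
            F `<=` boundary T1 `&` boundary T2]) \/
         (exists2 T, elements M T & F `<=` boundary T `&` boundary Omega))].

Definition facets_of M T : set (set pt) :=
  [set F | facets M F /\ F `<=` boundary T].

Definition shared_facets M T1 T2 : set (set pt) :=
  facets_of M T1 `&` facets_of M T2.

Definition voronoi_tessellation Omega M : Prop :=
  polytopal_mesh Omega M /\
  exists v : set pt -> pt, forall T, elements M T ->
    T = [set x | Omega x /\ forall T', elements M T' -> T' <> T ->
                   norm2 (x - v T) < norm2 (x - v T')].

End Meshes.

Section DualMesh.

Record digraph (V : Type) := Digraph {
  vertices : set V;
  edges : set (V * V) }.

(* cycle also accepts closed walks that repeat vertices; these exist if and
   only if simple directed cycles do. *)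
Definition acyclic (V : Type) (G : digraph V) : Prop :=
  forall c : seq V, c <> [::] ->
    ~ cycle (fun x y => `[< edges G (x, y) >]) c.

Variables (R : realType) (d : nat).

(* When several shared facets have different normals, one point of one of them
   with omega . nu > 0 is enough to create the edge. *)
Definition directed_dual_mesh (M : mesh R d) (omega : 'rV[R]_d) :
    digraph (set 'rV[R]_d) :=
  Digraph (elements M)
    [set e | [/\ elements M e.1, elements M e.2, e.1 <> e.2,
       shared_facets M e.1 e.2 !=set0 &
       exists F x nu, [/\ shared_facets M e.1 e.2 F, F x,
         outward_unit_normal e.1 x nu & 0 < dot omega nu]]].

Definition omnidirectionally_acyclic (M : mesh R d) : Prop :=
  forall omega, sphere omega -> acyclic (directed_dual_mesh M omega).

End DualMesh.

(* Main.v *)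
Require Import Defs.
From mathcomp Require Import all_boot all_order all_algebra.
From mathcomp Require Import all_classical all_reals all_analysis.
From mathcomp Require Import lra.

Import numFieldNormedType.Exports.

(** If [T1] has outward normal [nu] at a point of a facet shared with [T2], then
    that point is equidistant from the centres [v1] and [v2], and the half-space
    that coincides with [T1] near it lies in the half-space of the points closer
    to [v1] than to [v2]. Hence [v2 - v1] is a positive multiple of [nu], so that
    every edge of the dual mesh directed by [omega] strictly increases
    [omega . v], which excludes cycles. *)

Import Order.TTheory GRing.Theory Num.Theory.
Local Open Scope classical_set_scope.
Local Open Scope ring_scope.

Section Dot.
Context {R : realType} {d : nat}.
Implicit Types x y z a : 'rV[R]_d.

Lemma dotC x y : dot x y = dot y x.
Proof. by apply: eq_bigr => i _; rewrite mulrC. Qed.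

Lemma dotDr x y z : dot x (y + z) = dot x y + dot x z.
Proof. by rewrite -big_split; apply: eq_bigr => i _; rewrite mxE mulrDr. Qed.

Lemma dotZr (t : R) x y : dot x (t *: y) = t * dot x y.
Proof. by rewrite /dot mulr_sumr; apply: eq_bigr => i _; rewrite mxE mulrCA. Qed.

Lemma dotNr x y : dot x (- y) = - dot x y.
Proof. by rewrite -scaleN1r dotZr mulN1r. Qed.

Lemma dotBr x y z : dot x (y - z) = dot x y - dot x z.
Proof. by rewrite dotDr dotNr. Qed.

Lemma dotBl x y z : dot (x - y) z = dot x z - dot y z.
Proof. by rewrite dotC dotBr !(dotC z). Qed.

Lemma dot_ge0 x : 0 <= dot x x.
Proof. by apply: sumr_ge0 => i _; rewrite -expr2 sqr_ge0. Qed.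

Lemma dot_eq0 x : dot x x = 0 -> x = 0.
Proof.
move=> /eqP; rewrite psumr_eq0 => [/allP x0|i _]; last by rewrite -expr2 sqr_ge0.
apply/rowP => i; rewrite mxE; apply/eqP.
by have := x0 i (mem_index_enum i); rewrite /= mulf_eq0 orbb.
Qed.

Lemma norm2_lt x y : norm2 x < norm2 y -> dot x x < dot y y.
Proof. by rewrite !ltNge; apply: contra; exact: ler_wsqrtr. Qed.

Lemma norm2_eq1 x : norm2 x = 1 -> dot x x = 1.
Proof. by move=> x1; rewrite -(sqr_sqrtr (dot_ge0 x)) -/(norm2 x) x1 expr1n. Qed.

Lemma dot_continuous a : continuous (dot a).
Proof.
apply: continuous_big => [|i _ x]; first exact: add_continuous.
by apply: cvgMl_tmp (@coord_continuous R 1 d 0 i x).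
Qed.

Lemma closure_dot_le (A : set 'rV[R]_d) a (b : R) :
  (forall y, A y -> dot a y <= b) -> forall x, closure A x -> dot a x <= b.
Proof.
move=> Ab; have Hcl : closed (dot a @^-1` [set r | r <= b]).
  by apply: closed_comp (@closed_le _ b) => y _; exact: dot_continuous.
by move=> x Ax; apply: (Hcl x); exact: closure_subset Ax.
Qed.

(** Squaring both distances cancels the quadratic term [dot z z], so being closer to [x] than to [y]
    is a linear condition on [z]. *)
Lemma closer_dot_lt x y z : norm2 (z - x) < norm2 (z - y) ->
  2 * dot (y - x) z < dot y y - dot x x.
Proof.
move=> /norm2_lt; rewrite !dotBl !dotBr (dotC z x) (dotC z y); lra.
Qed.

Lemma near_ray (P : set 'rV[R]_d) x z :
  (\forall y \near x, P y) -> exists2 t : R, 0 < t & P (x + t *: z).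
Proof.
move=> Px; have cvgx : x + t *: z @[t --> (0 : R)] --> x.
  rewrite -[X in _ --> X]addr0; apply: cvgD; first exact: cvg_cst.
  by rewrite -[X in _ --> X](scale0r z); apply: cvgZr_tmp; exact: cvg_id.
have /(cvg_at_right_filter cvgx) Pt := Px.
have [t [/= t0 ?]] := filter_ex (filterI (nbhs_right_gt (0 : R)) Pt).
by exists t.
Qed.

(** A component [u] of [w] orthogonal to [nu] could be followed without changing [dot nu], until
    [dot w] is no longer negative; so [u] vanishes. Testing [- nu] gives the sign. *)
Lemma half_space_sub_collinear (nu w : 'rV[R]_d) : dot nu nu = 1 ->
  (forall z, dot nu z < 0 -> dot w z < 0) ->
  0 < dot w nu /\ w = dot w nu *: nu.
Proof.
move=> nu1 sub; have c0 : 0 < dot w nu.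
  by rewrite -oppr_lt0 -dotNr; apply: sub; rewrite dotNr nu1 oppr_lt0.
split=> //; apply/subr0_eq/dot_eq0; set c := dot w nu in c0 *.
set u := w - c *: nu; have nuu : dot nu u = 0.
  by rewrite /u dotBr dotZr nu1 (dotC nu) mulr1 subrr.
have wu : dot w u = dot u u.
  by rewrite {2}/u dotBl (dotC (_ *: _)) dotZr (dotC u) nuu mulr0 subr0.
apply/eqP; rewrite eq_le dot_ge0 andbT leNgt; apply/negP => uu.
(* The coefficient of [u] is chosen so that [dot w] vanishes at this point: [u] contributes [c] and
   [- nu] contributes [- c]. *)
have /sub : dot nu ((c / dot u u) *: u - nu) < 0.
  by rewrite dotBr dotZr nuu mulr0 nu1 sub0r oppr_lt0.
by rewrite dotBr dotZr wu divfK ?gt_eqF// subrr ltxx.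
Qed.

End Dot.

Lemma outward_normal_bisector {R : realType} {d : nat}
    (T1 T2 : set 'rV[R]_d) (v1 v2 x nu : 'rV[R]_d) :
  (forall y, T1 y -> norm2 (y - v1) < norm2 (y - v2)) ->
  (forall y, T2 y -> norm2 (y - v2) < norm2 (y - v1)) ->
  closure T1 x -> closure T2 x -> outward_unit_normal T1 x nu ->
  exists2 c : R, 0 < c & v2 - v1 = c *: nu.
Proof.
move=> T1v T2v T1x T2x [/norm2_eq1 nu1 T1nu].
(* The bisector of the two centres is the hyperplane where [dot (v2 - v1)] equals [b]. *)
set b := (dot v2 v2 - dot v1 v1) / 2.
have T1b y : T1 y -> dot (v2 - v1) y < b.
  by move=> /T1v/closer_dot_lt; rewrite /b; lra.
(* [x] is a limit of points from both sides of the bisector. *)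
have xb : dot (v2 - v1) x = b.
  apply/eqP; rewrite eq_le; apply/andP; split.
    by apply: closure_dot_le T1x => y /T1b/ltW.
  have : dot (v1 - v2) x <= - b.
    by apply: closure_dot_le T2x => y /T2v/closer_dot_lt; rewrite /b; lra.
  by rewrite !dotBl; lra.
have [] := @half_space_sub_collinear _ _ nu (v2 - v1) nu1; last first.
  by move=> c0 ->; exists (dot (v2 - v1) nu).
(* The normal describes [T1] only near [x], but any direction [z] can be shortened to [t *: z];
   since [x] lies on the bisector, the factor [t] then drops out by homogeneity. *)
move=> z nuz; have [t t0 T1t] := near_ray _ _ z T1nu.
have /T1b : T1 (x + t *: z).
  by apply/T1t; rewrite addrAC subrr add0r dotZr pmulr_rlt0.
by rewrite dotDr xb dotZr gtrDl pmulr_rlt0.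
Qed.

(** Going once around a cycle from [x] would give [f x < f x] by transitivity. *)
Lemma acyclic_potential {R : realType} {V : Type} (G : digraph V) (f : V -> R) :
  (forall x y, edges G (x, y) -> f x < f y) -> acyclic G.
Proof.
move=> fG [//|x c] _ /= /(@sub_path _ _ (relpre f <%R)) => cyc.
have /cyc : subrel (fun x y => `[< edges G (x, y) >]) (relpre f <%R).
  by move=> y z /asboolP/fG.
move=> /(order_path_min (fun y z t => @lt_trans _ _ (f y) (f z) (f t))).
by rewrite all_rcons /= ltxx.
Qed.

Theorem theorem4p4 (R : realType) (d : nat) (Omega : set 'rV[R]_d)
    (M : mesh R d) (hd : (2 <= d)%N)
    (hOmega : polytopal_domain Omega) (hbounded : bounded_set Omega)
    (hM : voronoi_tessellation Omega M) :
  omnidirectionally_acyclic M.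
Proof.
move=> omega _; have [_ [v vor]] := hM.
apply: (@acyclic_potential _ _ _ (fun T => dot omega (v T))).
move=> T1 T2 [/= MT1 MT2 T12 _ [F [x [nu [[[_ F1] [_ F2]] Fx nux onu]]]]].
have closer T T' : elements M T -> elements M T' -> T' <> T ->
    forall y, T y -> norm2 (y - v T) < norm2 (y - v T').
  by move=> MT MT' TT' y; rewrite {1}(vor _ MT) => -[_]; apply.
(* A shared facet lies in both boundaries, hence [x] lies in both closures. *)
have [c c0 vc] := outward_normal_bisector _ _ _ _ _ _
  (closer _ _ MT1 MT2 (nesym T12)) (closer _ _ MT2 MT1 T12)
  (F1 _ Fx).1 (F2 _ Fx).1 nux.
by rewrite -subr_gt0 -dotBr vc dotZr mulr_gt0.
Qed.
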